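(* Let $G$ be a paratopological group (no separation axiom is assumed) which has a suitable set. Then $G$ is a $T_1$-space or $G$ is a two-element group.
   Context: A paratopological group is a group $G$ endowed with a topology such that the group operation $G\times G\to G$ is continuous (inversion need not be continuous). The identity of $G$ is denoted by $e$. A subset $S$ of a paratopological group $G$ is a suitable set for $G$ if $S$ is a discrete subspace of $G$, $S\cup\{e\}$ is closed in $G$, and the subgroup $\langle S\rangle$ of $G$ generated by $S$ is dense in $G$. *)

(* Defs.v *)
From HB Require Import structures.
From mathcomp Require Import all_boot all_order all_algebra.
From mathcomp Require Import all_classical all_reals all_analysis.

Set Implicit Arguments.
Unset Strict Implicit.
Unset Printing Implicit Defensive.

Local Open Scope classical_set_scope.
Local Open Scope group_scope.

HB.structure Definition PreTopologicalGroup :=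
  {G of Topological G & Group G}.

HB.mixin Record PreTopologicalGroup_isParatopological G
    & PreTopologicalGroup G := {
  mulg_continuous : continuous (fun x : G * G => x.1 * x.2)
}.

#[short(type="paratopologicalGroupType")]
HB.structure Definition ParatopologicalGroup :=
  {G of PreTopologicalGroup G & PreTopologicalGroup_isParatopological G}.

(* [subspace S] has the carrier of the ambient space; points outside [S] are
   made isolated, hence the restriction to the [A] contained in [S]. *)
Definition discrete_subspace (T : topologicalType) (S : set T) : Prop :=
  forall A : set (subspace S), A `<=` S -> open A.

Definition generated_subgroup (G : groupType) (S : set G) : set G :=
  smallest (fun H : set G => group_closed (mem H)) S.

Definition suitable_set (G : paratopologicalGroupType) (S : set G) : Prop :=
  [/\ discrete_subspace S,
      closed (S `|` [set 1]) &
      dense (generated_subgroup S)].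

(* Main.v *)
Require Import Defs.
From mathcomp Require Import all_boot all_order all_algebra.
From mathcomp Require Import all_classical all_reals all_analysis.

Local Open Scope classical_set_scope.
Local Open Scope card_scope.

(** If [G] is not [T_1], translation yields [a <> 1] in the closure of [1], and
    then [t a] lies in the closure of [t] for every [t].  The closed set
    [S `|` [set 1]] contains the closure of each of its points, while distinct
    points of the discrete set [S] are not in each other's closure; hence
    [a \in S], and [t a = 1] for every [t \in S].  So [a a = 1] and [S = {a}],
    and [{1, a}] is a closed subgroup containing [S], equal to [G] by density. *)

Lemma closure_image {T U : topologicalType} {f : T -> U} {A : set T} {x : T} :
  {for x, continuous f} -> closure A x -> closure (f @` A) (f x).
Proof.
by move=> fx Ax B /fx /Ax[t [At Bft]]; exists (f t); split => //; exists t.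
Qed.

(** If no open set contains [x] and misses [y], every neighbourhood of [x] contains [y]. *)
Lemma not_accessible_closure1 {T : topologicalType} :
  ~ accessible_space T -> exists x y : T, x != y /\ closure [set y] x.
Proof.
move=> nT1; apply: contrapT => noxy; apply: nT1 => x y xy.
apply: contrapT => noA; apply: noxy; exists x, y; split=> // B.
rewrite nbhsE => -[A [oA Ax] AB]; exists y; split=> //; apply: AB.
apply: contrapT => nAy; apply: noA; exists A.
by split=> //; apply/mem_set.
Qed.

Lemma closed_closure1 {T : topologicalType} {C : set T} {x y : T} :
  closed C -> closure [set y] x -> C y -> C x.
Proof. by move=> Ccl xy Cy; apply: Ccl => B /xy[_ [-> By]]; exists y. Qed.

(** Discreteness makes [[set x]] the trace on [S] of an open [V]; as a neighbourhood of [x], [V]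
    contains [y], so [y] lies in that trace. *)
Lemma discrete_subspace_closure1 {T : topologicalType} {S : set T} {x y : T} :
  discrete_subspace S -> closure [set y] x -> S x -> S y -> x = y.
Proof.
move=> dS xy Sx Sy.
have /open_subspaceP[V oV VS] : open ([set x] : set (subspace S)).
  by apply: dS => _ ->.
have [Vx _] : (V `&` S) x by rewrite VS.
have [_ [-> Vy]] := xy _ (open_nbhs_nbhs (conj oV Vx)).
by have [->] : ([set x] `&` S) y by rewrite -VS.
Qed.

Local Open Scope group_scope.

Section Translations.
Context {G : paratopologicalGroupType}.

Lemma mulgr_continuous (z : G) : continuous (fun x : G => x * z).
Proof.
move=> x; apply: (@continuous_comp _ _ _ (fun x => (x, z))
  (fun u : G * G => u.1 * u.2)); last exact: mulg_continuous.
by apply: cvg_pair => //=; exact: cvg_cst.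
Qed.

Lemma mulgl_continuous (z : G) : continuous (fun x : G => z * x).
Proof.
move=> x; apply: (@continuous_comp _ _ _ (fun x => (z, x))
  (fun u : G * G => u.1 * u.2)); last exact: mulg_continuous.
by apply: cvg_pair => //=; exact: cvg_cst.
Qed.

Lemma closure1_mulgr {x y : G} (z : G) :
  closure [set y] x -> closure [set y * z] (x * z).
Proof.
by move=> /(closure_image (mulgr_continuous z x)); rewrite image_set1.
Qed.

Lemma closure1_mulgl {x y : G} (z : G) :
  closure [set y] x -> closure [set z * y] (z * x).
Proof.
by move=> /(closure_image (mulgl_continuous z x)); rewrite image_set1.
Qed.

End Translations.

Lemma group_closed_involution {G : groupType} {a : G} :
  a * a = 1 -> group_closed (mem [set 1; a]).
Proof.
move=> aa; have aV : a^-1 = a by apply: (mulgI a); rewrite mulgV.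
split=> [|x y]; first by apply/mem_set; left.
move=> /set_mem[] -> /set_mem[] ->; apply/mem_set;
  rewrite ?invg1 ?mulg1 ?mul1g ?aV ?aa; by [left | right].
Qed.

Lemma card_set2 {T : choiceType} {x y : T} : x != y -> [set x; y] #= `I_2.
Proof.
(* The indicator of [y] sends [x] to 0 and [y] to 1. *)
move=> xy; apply/card_set_bijP; exists (fun t => (t == y) : nat); split.
- by move=> t _ /=; case: (t == y).
- by move=> s t; rewrite !inE => -[] -> [] -> //; rewrite eqxx (negbTE xy).
- move=> [|[|//]] _ /=; [exists x; [by left|] | exists y; [by right|]].
    by rewrite (negbTE xy).
  by rewrite eqxx.
Qed.

Theorem proposition2p1 (G : paratopologicalGroupType)
    (hG : exists S : set G, suitable_set S) :
  accessible_space G \/ [set: G] #= `I_2.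
Proof.
have [S [dS cS gS]] := hG.
have [|/not_accessible_closure1[x [y [xy clxy]]]] := pselect (accessible_space G).
  by left.
(* Right translation by [y^-1] moves the pair [x], [y] to [a], [1]. *)
right; set a := x * y^-1.
have a1 : a <> 1 by move=> /divg1_eq xyE; rewrite xyE eqxx in xy.
have cla : closure [set 1] a by rewrite -(mulgV y); exact: closure1_mulgr.
have Sa : S a by case: (closed_closure1 cS cla (or_intror erefl)).
have SaE t : S t -> t * a = 1.
  move=> St; have := closure1_mulgl t cla; rewrite mulg1 => clta.
  (* If [t * a] were in [S], discreteness would give [t * a = t], that is [a = 1]. *)
  have [Sta|//] := closed_closure1 cS clta (or_introl St).
  case: a1; apply: (mulgI t); rewrite mulg1.
  exact: (discrete_subspace_closure1 dS clta).
have aa := SaE _ Sa.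
have SE t : S t -> t = a by move=> /SaE ta; apply: (mulIg a); rewrite ta.
have genS : generated_subgroup S `<=` [set 1; a].
  by apply: smallest_sub; [exact: group_closed_involution | move=> t /SE; right].
suff -> : [set: G] = [set 1; a] by apply: card_set2; apply/eqP => /esym.
apply/seteqP; split=> // g _; apply: contrapT => ng.
(* A point [g] outside [[set 1; a]] makes the open complement of the suitable set with [1] nonempty.
   By density it contains some [h] of the generated subgroup, but [h] is [1] or [a], both
   excluded. *)
have [|h [nh /genS[hE|hE]]] := gS (~` (S `|` [set 1])) _ (closed_openC cS).
- by exists g => -[/SE ga|g1]; apply: ng; [right | left].
- by apply: nh; right.
- by apply: nh; left; rewrite hE.
Qed.
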